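(* Let $\mathbf{g}=(g_1,\ldots,g_m)$ be a vector of polynomials in $\mathbb{R}[\mathbf{x}]$, $\mathbf{x}=(x_1,\ldots,x_n)$, such that $\mathscr{X}=\{\mathbf{x}\in\mathbb{R}^n : g_i(\mathbf{x})\ge 0,\ i=1,\ldots,m\}$ is nonempty and compact. Assume that there is $R>0$, the radius of a Euclidean ball including $\mathscr{X}$, such that $R^2-\sum_{i=1}^n x_i^2\in\mathscr{Q}(\mathbf{g})^r_2$ for all integers $r\ge 1$. Then for every degree $d\ge 0$ the exactness cones are monotonically embedded for increasing relaxation order: for every integer $r\ge 1$, \[ \mathbb{R}[\mathbf{x}]_0\subset\mathscr{F}(\mathbf{g})^r_d\subset\mathscr{F}(\mathbf{g})^{r+1}_d\subset\overline{\mathscr{F}(\mathbf{g})^\infty_d}=\mathbb{R}[\mathbf{x}]_d, \] where \[ \overline{\mathscr{F}(\mathbf{g})^\infty_d}:=\Big\{f\in\mathbb{R}[\mathbf{x}]_d : f-v(f)\in\overline{\mathscr{Q}(\mathbf{g})^\infty_d}\Big\},\qquad \mathscr{Q}(\mathbf{g})^\infty_d:=\bigcup_{r\ge 1}\mathscr{Q}(\mathbf{g})^r_d, \] and $\overline{\mathscr{Q}(\mathbf{g})^\infty_d}$ is the topological closure of $\mathscr{Q}(\mathbf{g})^\infty_d$ in the finite-dimensional space $\mathbb{R}[\mathbf{x}]_d$.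
   Context: $\mathbb{R}[\mathbf{x}]_d$ is the vector space of real polynomials in $\mathbf{x}=(x_1,\ldots,x_n)$ of degree at most $d$ (so $\mathbb{R}[\mathbf{x}]_0$ is the space of constants), and $\Sigma[\mathbf{x}]\subset\mathbb{R}[\mathbf{x}]$ is the convex cone of sums of squares of polynomials. For $f\in\mathbb{R}[\mathbf{x}]_d$, $v(f):=\min_{\mathbf{x}\in\mathscr{X}}f(\mathbf{x})$. With $g_0:=1$, the truncated quadratic module is \[ \mathscr{Q}(\mathbf{g})^r_d:=\Big\{p\in\mathbb{R}[\mathbf{x}]_d : p=\sum_{i=0}^m s_i g_i,\ s_i\in\Sigma[\mathbf{x}],\ s_i g_i\in\mathbb{R}[\mathbf{x}]_{2r}\Big\}. \] The exactness cone of degree $d$ at relaxation order $r$ is \[ \mathscr{F}(\mathbf{g})^r_d:=\{f\in\mathbb{R}[\mathbf{x}]_d : f-v(f)\in\mathscr{Q}(\mathbf{g})^r_d\}. \] The symbol $\subset$ denotes inclusion, not necessarily strict. *)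

(* Defs.v *)
(* Polynomials are the {mpoly R[n]} of multinomials, over a realType of
   MathComp-Analysis. The notations of mpoly clash with those of
   MathComp-Analysis and are not imported:
     mpoly n R = {mpoly R[n]},  mpolyC n c = c%:MP,  mpolyX R (mnm1 i) = 'X_i,
     mcoeff m p = p@_m,  meval v p = p.@[v],  bmultinom n k = 'X_{1..n < k}. *)
From HB Require Import structures.
From mathcomp Require Import all_boot all_order all_algebra.
From mathcomp Require Import all_classical all_reals all_analysis.
From mathcomp Require Import -(notations) mpoly.

Set Implicit Arguments.
Unset Strict Implicit.
Unset Printing Implicit Defensive.

Import Order.TTheory GRing.Theory Num.Theory.
Import numFieldNormedType.Exports.

Local Open Scope classical_set_scope.
Local Open Scope ring_scope.

(* R[x]_d; [msize p] is the degree plus one, and [msize 0 = 0], so that 0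
   belongs to R[x]_d for every d. *)
Definition polys_deg (R : realType) (n d : nat) : set (mpoly n R) :=
  [set p | (msize p <= d.+1)%N].
Arguments polys_deg R n d : clear implicits.

Definition sos (R : realType) (n : nat) : set (mpoly n R) :=
  [set p | exists qs : seq (mpoly n R), p = \sum_(q <- qs) q ^+ 2].
Arguments sos R n : clear implicits.

Definition peval (R : realType) (n : nat) (p : mpoly n R) (x : 'rV[R]_n) : R :=
  meval (fun i => x 0 i) p.

Definition feasible (R : realType) (n m : nat) (g : 'I_m -> mpoly n R) :
    set 'rV[R]_n :=
  [set x | forall i, 0 <= peval (g i) x].

(* The family (g_0, g_1, ..., g_m) with g_0 = 1. *)
Definition with_one (R : realType) (n m : nat) (g : 'I_m -> mpoly n R)
    (i : 'I_m.+1) : mpoly n R :=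
  if unlift ord0 i is Some j then g j else 1.

Definition qmodule (R : realType) (n m : nat) (g : 'I_m -> mpoly n R)
    (r d : nat) : set (mpoly n R) :=
  [set p | polys_deg R n d p /\
    exists s : 'I_m.+1 -> mpoly n R,
      [/\ forall i, sos R n (s i),
          forall i, polys_deg R n (2 * r) (s i * with_one g i) &
          p = \sum_(i < m.+1) s i * with_one g i]].

Definition qmodule_infty (R : realType) (n m : nat) (g : 'I_m -> mpoly n R)
    (d : nat) : set (mpoly n R) :=
  \bigcup_(r in [set r | (1 <= r)%N]) qmodule g r d.

(* v(f): the least element of the set of values of f on the feasible set (and 0
   by convention when there is none; there is one whenever the feasible set is
   nonempty and compact). *)
Definition min_feasible (R : realType) (n m : nat) (g : 'I_m -> mpoly n R)
    (f : mpoly n R) : R :=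
  let values := [set peval f x | x in feasible g] in
  xget 0 (values `&` lbound values).

Definition exact_cone (R : realType) (n m : nat) (g : 'I_m -> mpoly n R)
    (r d : nat) : set (mpoly n R) :=
  [set f | polys_deg R n d f /\
    qmodule g r d (f - mpolyC n (min_feasible g f))].

(* The vector of coefficients of the monomials of degree at most d. Restricted
   to R[x]_d, it is a linear isomorphism onto R^N, N the number of these
   monomials. *)
Definition coefs (R : realType) (n d : nat) (p : mpoly n R) :
    'rV[R]_#|{: bmultinom n d.+1}| :=
  \row_i mcoeff (bmnm (enum_val i)) p.

(* Closure in R[x]_d of a subset A of R[x]_d: the topology of this
   finite-dimensional space is the one of R^N transported along [coefs d]. *)
Definition closure_deg (R : realType) (n d : nat) (A : set (mpoly n R)) :
    set (mpoly n R) :=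
  [set p | polys_deg R n d p /\ closure (coefs d @` A) (coefs d p)].

Definition exact_cone_closure (R : realType) (n m : nat)
    (g : 'I_m -> mpoly n R) (d : nat) : set (mpoly n R) :=
  [set f | polys_deg R n d f /\
    closure_deg d (qmodule_infty g d) (f - mpolyC n (min_feasible g f))].

(* Main.v *)
(* The equality of the closure with R[x]_d is Putinar's Positivstellensatz: if
   f > 0 on the feasible set then f lies in the quadratic module. The proof is
   elementary and has two steps. First, on the compact box [-rho, rho]^n the
   polynomial f - lam * \sum_i (1 - c g_i)^(2N) (c g_i) is bounded below by a
   positive constant for suitable c, lam, N: with |c g_i| <= 1 on the box, the
   i-th term of the sum is at most c g_i where g_i < 0, and at most 1 / N
   elsewhere. Second, the polynomials s + t b with
   b = rho^2 - |x|^2 and s, t sums of squares form a semiring containing the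
   rho + x_l and rho - x_l, hence, by expansion in the Bernstein basis, every
   polynomial with a positive lower bound on the box. *)
Require Import Defs.
From HB Require Import structures.
From mathcomp Require Import all_boot all_order all_algebra.
From mathcomp Require Import ring lra.
From mathcomp Require Import all_classical all_reals all_analysis.
From mathcomp Require Import -(notations) mpoly.

Set Implicit Arguments.
Unset Strict Implicit.
Unset Printing Implicit Defensive.

Import Order.TTheory GRing.Theory Num.Theory.
Import numFieldNormedType.Exports.

Local Open Scope classical_set_scope.
Local Open Scope ring_scope.

(** * Factorial moments of the binomial distribution, and falling factorials compared with powers *)

Lemma sum_ffact_bin (A : comNzRingType) (y z : A) (j k : nat) :
  y + z = 1 ->
  \sum_(i < k.+1) (i ^_ j * 'C(k, i))%:R * (y ^+ i * z ^+ (k - i)) =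
    (k ^_ j)%:R * y ^+ j.
Proof.
move=> yz; elim: j k => [|j IH] k.
  have -> : (k ^_ 0)%:R * y ^+ 0 = (z + y) ^+ k by rewrite addrC yz expr1n mulr1.
  rewrite exprDn.
  apply: eq_bigr => i _.
  by rewrite ffactn0 mul1n mulr_natl mulrC.
rewrite big_ord_recl ffact0n !mul0r add0r.
case: k => [|k]; first by rewrite big_ord0 ffact0n mul0r.
rewrite ffactSS exprS natrM mulrACA -IH mulr_sumr.
apply: eq_bigr => i _ /=.
(* The absorption identity (i + 1) C(k + 1, i + 1) = (k + 1) C(k, i) lowers [j] and [k] together. *)
rewrite /bump /= add1n subSS ffactSS exprS mulnAC -mul_bin_diag /=.
by rewrite !natrM; ring.
Qed.

(** Exchanging [a] for [b] one factor at a time costs at most [|a i - b i|] per index, because all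
    the other factors lie in [0, 1]. *)
Lemma ler_dist_prod (R : realFieldType) (I : Type) (s : seq I) (a b : I -> R) :
  (forall i, 0 <= a i <= 1) -> (forall i, 0 <= b i <= 1) ->
  `|\prod_(i <- s) a i - \prod_(i <- s) b i| <= \sum_(i <- s) `|a i - b i|.
Proof.
move=> ha hb; elim: s => [|i s IH]; first by rewrite !big_nil subrr normr0.
rewrite !big_cons.
set P := \prod_(_ <- _) _ in IH *; set Q := \prod_(_ <- _) _ in IH *.
have /andP[a0 a1] := ha i.
have Q0 : 0 <= Q by apply: prodr_ge0 => j _; have /andP[] := hb j.
have Q1 : Q <= 1 by apply: prodr_ile1 => j _; exact: hb.
rewrite (_ : a i * P - b i * Q = (a i - b i) * Q + a i * (P - Q)); last by ring.
apply: (le_trans (ler_normD _ _)); rewrite !normrM.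
rewrite (ger0_norm Q0) (ger0_norm a0); apply: lerD.
  by apply: ler_piMr.
by apply: le_trans IH; apply: ler_piMl.
Qed.

Lemma ffact_ratioE (R : realFieldType) (i j k : nat) :
  (i ^_ j)%:R / (k ^_ j)%:R = \prod_(t < j) ((i - t)%:R / (k - t)%:R) :> R.
Proof. by rewrite !ffact_prod !natr_prod -prodf_div. Qed.

(** The ratio has [j] factors (i - t)/(k - t). Each differs from i/k by t(k - i)/(k(k - t)) <= t/k
    <= j/k when t <= i. *)
Lemma ffact_ratio_approx (R : realFieldType) (i j k : nat) :
  (i <= k)%N -> (j <= k)%N ->
  `|(i ^_ j)%:R / (k ^_ j)%:R - (i%:R / k%:R) ^+ j| <= (j ^ 2)%:R / k%:R :> R.
Proof.
move=> ik jk; rewrite ffact_ratioE -[j in _ ^+ j]card_ord -prodr_const.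
have ratio01 (a b : nat) : (a <= b)%N -> 0 <= (a%:R / b%:R : R) <= 1.
  move=> ab; rewrite divr_ge0 ?ler0n //=; case: b ab => [|b] ab.
    by rewrite invr0 mulr0.
  by rewrite ler_pdivrMr ?ltr0Sn// mul1r ler_nat.
apply: (le_trans (ler_dist_prod _ _ _)) => [t|t|].
- exact/ratio01/leq_sub2r.
- exact: ratio01.
apply: (@le_trans _ _ (\sum_(t < j) (j%:R / k%:R : R))); last first.
  by rewrite sumr_const card_ord -[X in X <= _]mulr_natl mulrA -natrM mulnn.
apply: ler_sum => t _.
have tk : (t < k)%N by apply: leq_trans jk.
have k0 : 0 < k%:R :> R by rewrite ltr0n (leq_ltn_trans _ tk).
have kt0 : 0 < (k - t)%:R :> R by rewrite ltr0n subn_gt0.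
apply: (@le_trans _ _ (t%:R / k%:R)); last first.
  by rewrite ler_pM2r ?invr_gt0// ler_nat ltnW.
(* For t > i the truncated subtraction makes the factor 0, and its distance to i/k is i/k <= t/k. *)
have [ti|it] := leqP t i; last first.
  have /eqP-> : (i - t == 0)%N by rewrite subn_eq0 ltnW.
  by rewrite mul0r sub0r normrN ger0_norm ?divr_ge0 ?ler0n// ler_pM2r ?invr_gt0// ler_nat ltnW.
rewrite distrC.
have -> : i%:R / k%:R - (i - t)%:R / (k - t)%:R =
   (t%:R / k%:R) * ((k - i)%:R / (k - t)%:R) :> R.
  rewrite !natrB ?(ltnW tk)// in kt0 *.
  by field; rewrite !gt_eqF.
rewrite ger0_norm ?mulr_ge0 ?divr_ge0 ?ler0n//.
rewrite ler_piMr ?divr_ge0 ?ler0n//.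
by rewrite ler_pdivrMr// mul1r ler_nat leq_sub2l.
Qed.

(** * Bernstein expansions and positivity on a box in semirings of polynomials *)

Section Cone.
Variables (R : realType) (n : nat).
Local Notation P := (mpoly n R).

Definition conic_semiring (T : set P) :=
  [/\ forall c : R, 0 <= c -> T (mpolyC n c),
      forall p q, T p -> T q -> T (p + q) &
      forall p q, T p -> T q -> T (p * q)].

Lemma conic_semiring_sum (T : set P) (I : finType) (p : I -> P) :
  conic_semiring T -> (forall i, T (p i)) -> T (\sum_i p i).
Proof.
move=> [TC TD _] Tp; elim/big_ind: _ => //.
by rewrite -(mpolyC0 n R); exact: TC.
Qed.

Lemma conic_semiring_prod (T : set P) (I : finType) (p : I -> P) :
  conic_semiring T -> (forall i, T (p i)) -> T (\prod_i p i).
Proof.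
move=> [TC _ TM] Tp; elim/big_ind: _ => //.
by rewrite -(mpolyC1 n R); exact: TC.
Qed.

Lemma conic_semiringZ (T : set P) (c : R) (p : P) :
  conic_semiring T -> 0 <= c -> T p -> T (c *: p).
Proof. by move=> [TC _ TM] c0 Tp; rewrite -mul_mpolyC; apply: TM => //; exact: TC. Qed.

Lemma conic_semiringX (T : set P) (p : P) (k : nat) :
  conic_semiring T -> T p -> T (p ^+ k).
Proof.
move=> T_cone Tp; have := conic_semiring_prod (p := fun _ : 'I_k => p) T_cone (fun=> Tp).
by rewrite prodr_const card_ord.
Qed.

(** The factorial moment identity divided by [k ^_ j], which is nonzero because [j <= k]. *)
Lemma expr_bernstein (y z : P) (j k : nat) : (j <= k)%N -> y + z = 1 ->
  y ^+ j = \sum_(i < k.+1)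
    ((i ^_ j)%:R / (k ^_ j)%:R : R) *: ('C(k, i)%:R *: (y ^+ i * z ^+ (k - i))).
Proof.
move=> jk yz; have kj0 : (k ^_ j)%:R != 0 :> R.
  by rewrite pnatr_eq0 -lt0n ffact_gt0.
apply: (scalerI kj0); rewrite [LHS]scaler_nat -[LHS]mulr_natl -(sum_ffact_bin _ _ yz).
rewrite scaler_sumr; apply: eq_bigr => i _.
by rewrite scalerA [_ * (_ / _)]mulrC divfK// scalerA -natrM scaler_nat mulr_natl.
Qed.

Lemma mnm_le_msize (q : P) (m : multinom n) (l : 'I_n) :
  m \in msupp q -> (m l <= msize q)%N.
Proof.
move=> mq; apply: leq_trans (ltnW (msize_mdeg_lt mq)).
by rewrite mdegE (bigD1 l) //= leq_addr.
Qed.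

(** Tensor product of the univariate expansions. The coefficient at [f] is the value of [q] at the
    grid point f/k, except that each power (f l / k)^(m l) is replaced by a ratio of falling
    factorials. *)
Lemma mmap_bernstein (q : P) (y z : 'I_n -> P) (k : nat) :
  (msize q <= k)%N -> (forall l, y l + z l = 1) ->
  mmap (@mpolyC n R) y q = \sum_(f : {ffun 'I_n -> 'I_k.+1})
    (\sum_(m <- msupp q) mcoeff m q * \prod_(l < n) ((f l ^_ m l)%:R / (k ^_ m l)%:R)) *:
    \prod_(l < n) ('C(k, f l)%:R *: (y l ^+ f l * z l ^+ (k - f l))).
Proof.
move=> qk yz; under [RHS]eq_bigr do rewrite scaler_suml.
rewrite exchange_big /=; apply: eq_big_seq => m mq.
have mk l : (m l <= k)%N := leq_trans (mnm_le_msize l mq) qk.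
rewrite /mmap1 mul_mpolyC; under [RHS]eq_bigr do rewrite -scalerA.
rewrite -scaler_sumr; congr (_ *: _).
rewrite (eq_bigr _ (fun l _ => expr_bernstein (mk l) (yz l))) bigA_distr_bigA.
by apply: eq_bigr => f _; rewrite scaler_prod.
Qed.

(** Each Bernstein coefficient is within C/k of the value of [q] at a grid point of the unit box,
    and that value is at least [e]. Once C/k <= e, all coefficients are nonnegative and the
    expansion stays in [T]. *)
Lemma conic_semiring_unit_box (T : set P) (q : P) (y z : 'I_n -> P) (e : R) :
  conic_semiring T -> (forall l, y l + z l = 1) ->
  (forall l, T (y l)) -> (forall l, T (z l)) -> 0 < e ->
  (forall u : 'I_n -> R, (forall l, 0 <= u l <= 1) -> e <= meval u q) ->
  T (mmap (@mpolyC n R) y q).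
Proof.
move=> T_cone yz Ty Tz e0 qe.
(* [C] collects the errors j^2 of [ffact_ratio_approx] over the variables, weighted by the
   coefficients of [q]. *)
pose C : R := \sum_(m <- msupp q) `|mcoeff m q| * \sum_(l < n) (m l ^ 2)%:R.
have C0 : 0 <= C.
  by apply: sumr_ge0 => m _; rewrite mulr_ge0// sumr_ge0.
(* The first bound makes [k] dominate every exponent in [q]; the second gives C/k <= e. *)
pose k := maxn (msize q) (Num.bound (C / e)).
have Cke : C / k%:R <= e.
  have kC : C / e < k%:R.
    apply: (lt_le_trans (archi_boundP _)); first by rewrite divr_ge0// ltW.
    by rewrite ler_nat leq_maxr.
  have k0 : 0 < k%:R :> R by apply: le_lt_trans kC; rewrite divr_ge0// ltW.
  by rewrite ler_pdivrMr// mulrC -ler_pdivrMr// ltW.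
rewrite (@mmap_bernstein q y z k (leq_maxl _ _) yz).
apply: conic_semiring_sum => // f; apply: conic_semiringZ => //; last first.
  apply: conic_semiring_prod => // l; apply: conic_semiringZ => //.
  by case: (T_cone) => _ _; apply; exact: conic_semiringX.
have f01 l : 0 <= ((f l)%:R / k%:R : R) <= 1.
  rewrite divr_ge0//=; have := ltn_ord (f l); rewrite ltnS.
  case: (k) (f l : nat) => [|k'] i ik; first by rewrite invr0 mulr0.
  by rewrite ler_pdivrMr ?ltr0Sn// mul1r ler_nat.
have := qe _ f01; rewrite mevalE => qf.
set S := (X in 0 <= X); set S' := (X in e <= X) in qf.
suff : `|S - S'| <= e by rewrite ler_distl => /andP[+ _]; apply: le_trans; rewrite subr_ge0.
apply: le_trans Cke; rewrite /S /S' -sumrB mulr_suml.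
apply: (le_trans (ler_norm_sum _ _ _)); rewrite big_seq [leRHS]big_seq.
apply: ler_sum => m mq; rewrite -mulrBr normrM -mulrA; apply: ler_wpM2l => //.
have mk l : (m l <= k)%N := leq_trans (mnm_le_msize l mq) (leq_maxl _ _).
apply: (le_trans (ler_dist_prod _ _ _)) => [l|l|].
- rewrite divr_ge0//= ler_pdivrMr ?ltr0n ?ffact_gt0// mul1r ler_nat.
  rewrite !ffact_prod; apply: leq_prod => t _; apply: leq_sub2r.
  by rewrite -ltnS.
- have /andP[u0 u1] := f01 l; rewrite exprn_ge0// exprn_ile1//.
rewrite mulr_suml; apply: ler_sum => l _; apply: ffact_ratio_approx => //.
by rewrite -ltnS.
Qed.

Lemma conic_semiring_box (T : set P) (p : P) (rho e : R) :
  conic_semiring T -> 0 < rho ->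
  (forall l, T (mpolyC n rho + mpolyX R (mnm1 l))) ->
  (forall l, T (mpolyC n rho - mpolyX R (mnm1 l))) -> 0 < e ->
  (forall u : 'I_n -> R, (forall l, `|u l| <= rho) -> e <= meval u p) ->
  T p.
Proof.
move=> T_cone rho0 TD TB e0 pe.
pose c := (2 * rho)^-1.
have c0 : 0 < c by rewrite invr_gt0 mulr_gt0.
have crho : c * (2 * rho) = 1 by rewrite mulVf// gt_eqF// mulr_gt0.
pose y l : P := c *: (mpolyC n rho + mpolyX R (mnm1 l)).
pose z l : P := c *: (mpolyC n rho - mpolyX R (mnm1 l)).
have yz l : y l + z l = 1.
  rewrite -scalerDr addrACA subrr addr0 -mpolyCD -mul_mpolyC -mpolyCM.
  by rewrite -mulr2n -mulr_natl crho mpolyC1.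
(* [t] inverts the affine map [y] from the box to the unit box, so substituting [y] into [p]
   composed with [t] gives back [p]. *)
pose t l : P := (2 * rho) *: mpolyX R (mnm1 l) - mpolyC n rho.
have -> : p = mmap (@mpolyC n R) y (mmap (@mpolyC n R) t p).
  rewrite [mmap _ t p]/mmap raddf_sum /=.
  rewrite {1}[p]mpolyE; apply: eq_bigr => m _.
  rewrite mul_mpolyC mmapZ mul_mpolyC; congr (_ *: _).
  rewrite mpolyXE_id rmorph_prod /=; apply: eq_bigr => l _.
  rewrite rmorphXn /=; congr (_ ^+ _).
  rewrite /t raddfB /= mmapZ mmapX mmap1U mmapC /y mul_mpolyC scalerA.
  by rewrite (mulrC _ c) crho scale1r addrC addKr.
apply: (conic_semiring_unit_box T_cone yz _ _ e0) => [l|l|u u01].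
- by apply: conic_semiringZ => //; exact: ltW.
- by apply: conic_semiringZ => //; exact: ltW.
have -> : meval u (mmap (@mpolyC n R) t p) = meval (fun l => 2 * rho * u l - rho) p.
  rewrite [mmap _ t p]/mmap raddf_sum /= [RHS]mevalE; apply: eq_bigr => m _.
  rewrite mevalM mevalC; congr (_ * _); rewrite rmorph_prod; apply: eq_bigr => l _.
  by rewrite rmorphXn /= mevalB mevalZ mevalXU mevalC.
apply: pe => l; have /andP[u0 u1] := u01 l.
rewrite ler_norml; nra.
Qed.
End Cone.

(** * Continuity, and penalties on a compact set *)

Lemma continuous_peval (R : realType) (n : nat) (p : mpoly n R) :
  continuous (peval p).
Proof.
have -> : peval p = (fun x : 'rV[R]_n => \sum_(m <- msupp p)
    mcoeff m p * \prod_(i < n) x 0 i ^+ m i).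
  by apply/funext => x; rewrite /peval mevalE.
apply: continuous_big => [x|m _]; first apply: add_continuous.
suff cprod : continuous (fun x : 'rV[R]_n => \prod_(i < n) x 0 i ^+ m i).
  by move=> x; apply: (@continuousM _ _ (fun=> mcoeff m p)); [exact: cst_continuous|exact: cprod].
apply: continuous_big => [x|i _]; first apply: mul_continuous.
move=> y; apply: (@continuous_comp _ _ _ (fun x : 'rV[R]_n => x 0 i) (@GRing.exp R ^~ (m i))).
  exact: coord_continuous.
exact: exprn_continuous.
Qed.

(** On a nonempty [K] the function max(f, s) has a positive minimum [d]. Where f < d, one has s >=
    d, so the multiplier (|min f| + d)/d lifts [f] above [d]. *)
Lemma compact_penalty (R : realType) (T : topologicalType) (K : set T)
    (f s : T -> R) :
  compact K -> continuous f -> continuous s ->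
  (forall x, K x -> 0 <= s x) -> (forall x, K x -> s x = 0 -> 0 < f x) ->
  exists lam e, [/\ 0 <= lam, 0 < e & forall x, K x -> e <= f x + lam * s x].
Proof.
move=> cK cf cs s0 fpos.
have [K0|/set0P/negP/negPn/eqP ->] := pselect (K !=set0); last by exists 0, 1; split.
have cmax : continuous (fun x => Num.max (f x) (s x)).
  by move=> x; apply: continuous_max; [exact: cf|exact: cs].
have [a aK amin] := compact_EVT_min K0 cK (continuous_subspaceT cf).
have [b bK bmin] := compact_EVT_min K0 cK (continuous_subspaceT cmax).
set d := Num.max (f b) (s b) in bmin.
have d0 : 0 < d.
  rewrite inE in bK; rewrite /d lt_max.
  have [sb0|sb0] := eqVneq (s b) 0; first by rewrite fpos.
  by rewrite [0 < s b]lt_neqAle [0 == _]eq_sym sb0 s0 ?orbT.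
exists ((`|f a| + d) / d), d; split => // [|x Kx].
  by rewrite divr_ge0 ?addr_ge0// ltW.
have xK : x \in K by rewrite inE.
have := bmin _ xK; rewrite le_max => /orP[fx|sx].
  apply: le_trans fx _; rewrite lerDl; apply: mulr_ge0; last exact: s0.
  by apply: divr_ge0; [apply: addr_ge0 => //|]; exact: ltW.
have : `|f a| + d <= (`|f a| + d) / d * s x.
  rewrite mulrAC ler_pdivlMr//; apply: ler_wpM2l => //.
  by rewrite addr_ge0// ltW.
have := amin _ xK; have := ler_norm (- f a); rewrite normrN; lra.
Qed.

Lemma expr1B_le (R : realFieldType) (t : R) (N : nat) :
  0 <= t <= 1 -> (1 - t) ^+ N * (1 + N%:R * t) <= 1.
Proof.
move=> /andP[t0 t1]; elim: N => [|N IH]; first by rewrite mul0r addr0 mulr1.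
apply: le_trans IH; rewrite exprSr -mulrA; apply: ler_wpM2l.
  by rewrite exprn_ge0// subr_ge0.
have N0 : 0 <= N%:R :> R by [].
(* (1 - t)(1 + (N + 1)t) = 1 + Nt - (N + 1)t^2. *)
rewrite -natr1; nra.
Qed.

(** (|t| - t)/2 is the negative part of [t]. For t >= 0, [expr1B_le] gives t(1 - t)^N <= 1/N; for t
    < 0 the power is at least 1. The exponent is even so that the multiplier of [t] is a square. *)
Lemma penalty_ge (R : realFieldType) (t : R) (N : nat) : (0 < N)%N ->
  `|t| <= 1 -> (`|t| - t) / 2 - N%:R^-1 <= - (t * (1 - t) ^+ (N * 2)).
Proof.
move=> N0 t1; have Nr0 : 0 < N%:R :> R by rewrite ltr0n.
have [t0|t0] := leP 0 t.
  rewrite ger0_norm// in t1 *; rewrite subrr mul0r sub0r lerN2.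
  have b0 : 0 <= 1 - t by rewrite subr_ge0.
  have b1 : 1 - t <= 1 by rewrite gerBl.
  have h0 : 0 <= (1 - t) ^+ N by rewrite exprn_ge0.
  have h1 : (1 - t) ^+ N <= 1 by rewrite exprn_ile1.
  have := @expr1B_le _ t N; rewrite t0 t1 => /(_ isT) h.
  rewrite -[leRHS]mul1r ler_pdivlMr// exprM.
  have : t * N%:R * ((1 - t) ^+ N * (1 - t) ^+ N) <= t * N%:R * (1 - t) ^+ N.
    by rewrite ler_wpM2l ?mulr_ge0// ler_piMr.
  rewrite expr2; nra.
have h : 1 <= (1 - t) ^+ (N * 2) by rewrite exprn_ege1// lerBrDr addrC -lerBrDr subrr ltW.
have iN : 0 < N%:R^-1 :> R by rewrite invr_gt0.
rewrite ltr0_norm//; nra.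
Qed.

(** * Sums of squares, the preordering of a ball, and penalization by sums of squares *)

Section Sos.
Variables (R : realType) (n : nat).
Local Notation P := (mpoly n R).

Lemma sos_sqr (p : P) : sos R n (p ^+ 2).
Proof. by exists [:: p]; rewrite big_seq1. Qed.

Lemma sos0 : sos R n 0.
Proof. by exists [::]; rewrite big_nil. Qed.

Lemma sosC (c : R) : 0 <= c -> sos R n (mpolyC n c).
Proof. by move=> c0; rewrite -(sqr_sqrtr c0) rmorphXn; exact: sos_sqr. Qed.

Lemma sosD (p q : P) : sos R n p -> sos R n q -> sos R n (p + q).
Proof. by move=> [s ->] [t ->]; exists (s ++ t); rewrite big_cat. Qed.

Lemma sosM (p q : P) : sos R n p -> sos R n q -> sos R n (p * q).
Proof.
move=> [s ->] [t ->]; exists [seq x * y | x <- s, y <- t].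
rewrite big_allpairs_dep mulr_suml; apply: eq_bigr => x _.
by rewrite mulr_sumr; apply: eq_bigr => y _; rewrite exprMn.
Qed.

(* With a single generator, the quadratic module is also the preordering: this
   is what makes it stable under products. *)
Definition preordering1 (b : P) : set P :=
  [set p | exists s t, [/\ sos R n s, sos R n t & p = s + t * b]].

Lemma sos_preordering1 (b p : P) : sos R n p -> preordering1 b p.
Proof. by move=> sp; exists p, 0; split => //; [exact: sos0|rewrite mul0r addr0]. Qed.

Lemma preordering1_generator (b : P) : preordering1 b b.
Proof.
exists 0, 1; split; [exact: sos0| |by rewrite add0r mul1r].
by rewrite -(expr1n _ 2); exact: sos_sqr.
Qed.

Lemma preordering1_conic (b : P) : conic_semiring (preordering1 b).
Proof.
split=> [c c0|p q|p q].
- exact/sos_preordering1/sosC.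
- move=> [s [t [ss st ->]]] [s' [t' [ss' st' ->]]].
  exists (s + s'), (t + t'); split; [exact: sosD|exact: sosD|].
  by rewrite mulrDl addrACA.
move=> [s [t [ss st ->]]] [s' [t' [ss' st' ->]]].
(* The term in b^2 joins the part free of [b], since b^2 is a square. *)
exists (s * s' + t * t' * b ^+ 2), (s * t' + t * s'); split.
- by apply: sosD; [exact: sosM|apply: sosM; [exact: sosM|exact: sos_sqr]].
- by apply: sosD; exact: sosM.
by ring.
Qed.

Definition ball_poly (rho : R) : P :=
  mpolyC n (rho ^+ 2) - \sum_(i < n) mpolyX R (mnm1 i) ^+ 2.

(* 2 rho (rho + X) = (rho + X)^2 + (rho^2 - X^2). *)
Lemma preordering1_ball_linear (rho : R) (l : 'I_n) (e : bool) : 0 < rho ->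
  preordering1 (ball_poly rho) (mpolyC n rho + (-1) ^+ e * mpolyX R (mnm1 l)).
Proof.
move=> rho0; set b := ball_poly rho; set X := mpolyX R (mnm1 l).
have cone := preordering1_conic b; have [_ TD _] := cone.
have -> : mpolyC n rho + (-1) ^+ e * X = (2 * rho)^-1 *:
    ((mpolyC n rho + (-1) ^+ e * X) ^+ 2 + \sum_(i < n | i != l) mpolyX R (mnm1 i) ^+ 2 + b).
  apply: (@scalerI _ _ (2 * rho)); first by rewrite gt_eqF// mulr_gt0.
  rewrite scalerA mulfV ?scale1r; last by rewrite gt_eqF// mulr_gt0.
  set S := \sum_(_ < _ | _) _.
  rewrite /b /ball_poly (bigD1 l) //= -/X -/S rmorphXn /= -mul_mpolyC mpolyCM.
  rewrite (_ : mpolyC n 2 = 2) //; last by rewrite mpolyC_nat.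
  by case: e; rewrite ?expr0 ?expr1; ring.
apply: conic_semiringZ => //; first by rewrite invr_ge0 mulr_ge0// ltW.
apply: TD; last exact: preordering1_generator.
apply: sos_preordering1; apply: sosD; first exact: sos_sqr.
by elim/big_rec: _ => [|i p _]; [exact: sos0|apply: sosD; exact: sos_sqr].
Qed.

Lemma preordering1_ball_box (rho e : R) (p : P) : 0 < rho -> 0 < e ->
  (forall u : 'I_n -> R, (forall l, `|u l| <= rho) -> e <= meval u p) ->
  preordering1 (ball_poly rho) p.
Proof.
move=> rho0 e0; apply: conic_semiring_box => // [|l|l].
- exact: preordering1_conic.
- by have := @preordering1_ball_linear rho l false rho0; rewrite expr0 mul1r.
- by have := @preordering1_ball_linear rho l true rho0; rewrite expr1 mulN1r.
Qed.

Lemma compact_penalization (m : nat) (g : 'I_m -> P) (K : set 'rV[R]_n) (f : P) :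
  compact K -> (forall x, K x -> feasible g x -> 0 < peval f x) ->
  exists s : 'I_m -> P, exists e : R, [/\ forall i, sos R n (s i), 0 < e &
    forall x, K x -> e <= peval (f - \sum_i s i * g i) x].
Proof.
move=> cK fpos.
pose G (x : 'rV[R]_n) : R := \sum_i `|peval (g i) x|.
have cN i : continuous (fun x => `|peval (g i) x|).
  by move=> x; apply: continuous_comp; [exact: continuous_peval|exact: norm_continuous].
have cG : continuous G by apply: continuous_big => // x; apply: add_continuous.
have [C C0 GC] : exists2 C : R, 0 < C & forall x, K x -> G x <= C.
  have [K0|/set0P/negP/negPn/eqP ->] := pselect (K !=set0); last by exists 1.
  have [a _ amax] := compact_EVT_max K0 cK (continuous_subspaceT cG).
  exists (`|G a| + 1) => [|x Kx]; first by rewrite ltr_wpDl.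
  have := amax x; rewrite inE => /(_ Kx) h.
  by apply: (le_trans h); rewrite (le_trans (ler_norm _))// lerDl.
(* Twice the sum of the negative parts of the [g i]: it vanishes exactly on the feasible set. *)
pose S (x : 'rV[R]_n) : R := \sum_i (`|peval (g i) x| - peval (g i) x).
have cS : continuous S.
  apply: continuous_big => [x|i _ x]; first exact: add_continuous.
  exact: (continuousB (@cN i x) (@continuous_peval _ _ (g i) x)).
have S0 x : 0 <= S x by apply: sumr_ge0 => i _; rewrite subr_ge0 ler_norm.
have [|lam [e [lam0 e0 he]]] :=
  compact_penalty cK (@continuous_peval _ _ f) cS (fun x _ => S0 x).
  move=> x Kx Sx; apply: fpos => // i.
  have /eqP := Sx; rewrite psumr_eq0 => [|j _]; last by rewrite subr_ge0 ler_norm.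
  move=> /allP /(_ i); rewrite mem_index_enum => /(_ isT).
  by rewrite /= subr_eq0 => /eqP <-.
pose c := C^-1.
have c0 : 0 < c by rewrite invr_gt0.
(* Since a c / 2 = lam, scaling the bound of [penalty_ge] by [a] yields lam S, minus m errors a/N.
   The choice of [N] keeps their total below e/2. *)
pose a := 2 * C * lam.
have a0 : 0 <= a by rewrite mulr_ge0// mulr_ge0// ltW.
pose N := (Num.bound (a * m%:R / (e / 2))).+1.
have aN : a * m%:R * N%:R^-1 <= e / 2.
  rewrite ler_pdivrMr ?ltr0Sn// [leRHS]mulrC -ler_pdivrMr ?divr_gt0//.
  apply: (@le_trans _ _ (Num.bound (a * m%:R / (e / 2)))%:R).
    by apply/ltW; apply: archi_boundP; rewrite divr_ge0 ?mulr_ge0// ltW// divr_gt0.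
  by rewrite ler_nat.
exists (fun i => mpolyC n (a * c) * ((1 - c *: g i) ^+ N) ^+ 2), (e / 2); split.
- by move=> i; apply: sosM; [apply: sosC; rewrite mulr_ge0// ltW|exact: sos_sqr].
- by rewrite divr_gt0.
move=> x Kx; have := he x Kx.
have -> : peval (f - \sum_i mpolyC n (a * c) * (1 - c *: g i) ^+ N ^+ 2 * g i) x =
  peval f x + a * \sum_i - ((c * peval (g i) x) * (1 - c * peval (g i) x) ^+ (N * 2)).
  rewrite /peval mevalB; congr (_ + _); rewrite [meval _ _]raddf_sum -sumrN mulr_sumr /=.
  apply: eq_bigr => i _.
  by rewrite -exprM 2!mevalM mevalC rmorphXn /= mevalB meval1 mevalZ; ring.
have : \sum_i ((`|c * peval (g i) x| - c * peval (g i) x) / 2 - N%:R^-1) <=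
    \sum_i - (c * peval (g i) x * (1 - c * peval (g i) x) ^+ (N * 2)).
  apply: ler_sum => i _; apply: penalty_ge => //.
  rewrite normrM gtr0_norm// -ler_pdivlMl// invrK mulr1.
  apply: le_trans (GC x Kx); rewrite /G (bigD1 i) //= lerDl.
  by apply: sumr_ge0.
rewrite sumrB sumr_const card_ord => h1.
have := ler_wpM2l a0 h1.
have -> : \sum_(i < m) (`|c * peval (g i) x| - c * peval (g i) x) / 2 = c / 2 * S x.
  rewrite mulr_sumr; apply: eq_bigr => i _.
  by rewrite normrM (gtr0_norm c0); ring.
have -> : a * (c / 2 * S x - N%:R^-1 *+ m) = lam * S x - a * m%:R * N%:R^-1.
  rewrite -mulr_natl /a /c; field.
  by rewrite (gt_eqF C0) pnatr_eq0.
lra.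
Qed.
End Sos.

(** * Quadratic modules and Putinar's Positivstellensatz *)

Section QuadraticModule.
Variables (R : realType) (n m : nat) (g : 'I_m -> mpoly n R).
Local Notation P := (mpoly n R).

(** Free of degree bounds, hence stable under multiplication by sums of squares;
    [quadratic_module_qmodule_infty] restores the truncation. *)
Definition quadratic_module : set P :=
  [set p | exists s : 'I_m.+1 -> P,
    (forall i, sos R n (s i)) /\ p = \sum_(i < m.+1) s i * with_one g i].

Lemma quadratic_moduleD (p q : P) :
  quadratic_module p -> quadratic_module q -> quadratic_module (p + q).
Proof.
move=> [s [ss ->]] [t [st ->]]; exists (fun i => s i + t i); split.
  by move=> i; exact: sosD.
by rewrite -big_split; apply: eq_bigr => i _; rewrite mulrDl.
Qed.

Lemma quadratic_moduleMsos (t p : P) :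
  sos R n t -> quadratic_module p -> quadratic_module (t * p).
Proof.
move=> st [s [ss ->]]; exists (fun i => t * s i); split.
  by move=> i; exact: sosM.
by rewrite mulr_sumr; apply: eq_bigr => i _; rewrite mulrA.
Qed.

Lemma quadratic_module_with_one (t : P) (i : 'I_m.+1) :
  sos R n t -> quadratic_module (t * with_one g i).
Proof.
move=> st; exists (fun j => if j == i then t else 0); split.
  by move=> j; case: ifP => // _; exact: sos0.
rewrite (bigD1 i) //= eqxx big1 ?addr0// => j /negbTE ->; exact: mul0r.
Qed.

Lemma sos_quadratic_module (t : P) : sos R n t -> quadratic_module t.
Proof.
move=> st; have := quadratic_module_with_one ord0 st.
by rewrite /with_one unlift_none mulr1.
Qed.

Lemma quadratic_module_gen (t : P) (i : 'I_m) :
  sos R n t -> quadratic_module (t * g i).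
Proof.
move=> st; have := quadratic_module_with_one (lift ord0 i) st.
by rewrite /with_one liftK.
Qed.

Lemma qmodule_quadratic_module (r d : nat) : qmodule g r d `<=` quadratic_module.
Proof. by move=> p [_ [s [ss _ ->]]]; exists s. Qed.

Lemma quadratic_module_qmodule_infty (d : nat) (p : P) :
  polys_deg R n d p -> quadratic_module p -> qmodule_infty g d p.
Proof.
move=> pd [s [ss pE]].
(* A certificate has finitely many terms, so one order bounds all their degrees; the successor
   ensures order at least 1. *)
exists (\max_i msize (s i * with_one g i)).+1 => //; split => //.
exists s; split => // i; rewrite /polys_deg /=.
apply: (leq_trans (leq_bigmax (F := fun i => msize (s i * with_one g i)) i)).
by rewrite mul2n -addnn addSn; apply: leqW; apply: leqW; rewrite leq_addr.
Qed.

Theorem putinar (rho : R) (f : P) : 0 < rho ->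
  quadratic_module (ball_poly n rho) ->
  (forall x, feasible g x -> 0 < peval f x) -> quadratic_module f.
Proof.
move=> rho0 Qb fpos.
pose K := [set x : 'rV[R]_n | forall i, `[- rho, rho]%classic (x ord0 i)].
have cK : compact K by apply: (@rV_compact R n (fun=> `[- rho, rho]%classic)) => i; exact: segment_compact.
have [s [e [ss e0 he]]] := compact_penalization cK (fun x _ => fpos x).
rewrite -(subrK (\sum_i s i * g i) f); apply: quadratic_moduleD.
  have [|s0 [s1 [ss0 ss1 ->]]] := preordering1_ball_box rho0 e0 (p := f - \sum_i s i * g i).
    move=> u urho; have := he (\row_l u l); rewrite /peval.
    rewrite (@meval_eq _ _ _ u) => [|l]; last by rewrite mxE.
    by apply=> l /=; rewrite mxE in_itv /= -ler_norml.
  (* The ball polynomial is in the module, hence so is its product by [s1]. *)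
  apply: quadratic_moduleD; first exact: sos_quadratic_module.
  exact: quadratic_moduleMsos.
apply: (big_ind quadratic_module) => [|p q|i _].
- exact/sos_quadratic_module/sos0.
- exact: quadratic_moduleD.
- exact: quadratic_module_gen.
Qed.

(** * Minimum on the feasible set, closure, and the chain of inclusions *)

Lemma min_feasibleP (f : P) : feasible g !=set0 -> compact (feasible g) ->
  (exists2 x, feasible g x & peval f x = min_feasible g f) /\
  forall x, feasible g x -> min_feasible g f <= peval f x.
Proof.
move=> g0 cg.
have [c cg' cmin] := compact_EVT_min g0 cg (continuous_subspaceT (@continuous_peval _ _ f)).
rewrite /min_feasible; set A := _ `&` _.
(* A minimizer exists by compactness, so [xget] does not return its default value. *)
have : exists y, A y.
  rewrite inE in cg'.
  exists (peval f c); split; first by exists c.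
  by move=> _ [x gx <-]; apply: cmin; rewrite inE.
move=> /(xgetPex 0) [[x gx xE] lb]; split; first by exists x.
by move=> y gy; apply: lb; exists y.
Qed.

Lemma polys_degBC (d : nat) (f : P) (c : R) :
  polys_deg R n d f -> polys_deg R n d (f - mpolyC n c).
Proof.
rewrite /polys_deg /= => fd; apply: (leq_trans (msizeD_le _ _)).
by rewrite geq_max fd -mpolyCN msizeC; case: (_ != 0).
Qed.

(** Adding [e] moves only the constant coefficient, so p + e tends to [p] as [e] tends to 0. This
    matches Putinar's theorem, which needs strict positivity. *)
Lemma closure_degP (d : nat) (A : set P) (p : P) : polys_deg R n d p ->
  (forall e : R, 0 < e -> A (p + mpolyC n e)) -> closure_deg d A p.
Proof.
move=> pd Ae; split => // B /nbhs_ballP [e /= e0 eB].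
exists (coefs d (p + mpolyC n (e / 2))); split.
  by exists (p + mpolyC n (e / 2)) => //; apply: Ae; rewrite divr_gt0.
apply: eB; split => // i j; rewrite !mxE /ball /= mcoeffD opprD addNKr normrN.
rewrite mcoeffC normrM (gtr0_norm (divr_gt0 e0 _))//.
have [_|_] := eqVneq; rewrite ?normr1 ?normr0; lra.
Qed.

End QuadraticModule.

Theorem lemma1 (R : realType) (n m : nat) (g : 'I_m -> mpoly n R)
  (g_nonempty : feasible g !=set0)
  (g_compact : compact (feasible g))
  (g_archimedean : exists rho : R,
    [/\ 0 < rho,
        feasible g `<=` [set x : 'rV[R]_n | \sum_(i < n) x 0 i ^+ 2 <= rho ^+ 2] &
        forall r : nat, (1 <= r)%N ->
          qmodule g r 2
            (mpolyC n (rho ^+ 2) - \sum_(i < n) mpolyX R (mnm1 i) ^+ 2)]) :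
  forall (d r : nat), (1 <= r)%N ->
    [/\ polys_deg R n 0 `<=` exact_cone g r d,
        exact_cone g r d `<=` exact_cone g r.+1 d,
        exact_cone g r.+1 d `<=` exact_cone_closure g d &
        exact_cone_closure g d = polys_deg R n d].
Proof.
move=> d r r1; have [rho [rho0 _ /(_ 1%N isT) Qrho]] := g_archimedean.
have vP f := min_feasibleP f g_nonempty g_compact.
split.
- move=> f f0; split; first exact: leq_trans f0 _.
  (* A constant equals its own minimum. *)
  have -> : f - mpolyC n (min_feasible g f) = 0.
    have [[x _ <-] _] := vP f.
    by rewrite (msize1_polyC f0) /peval mevalC subrr.
  split; first by rewrite /polys_deg /= msize0.
  exists (fun=> 0); split => [i|i|]; first exact: sos0.
    by rewrite mul0r /polys_deg /= msize0.
  by rewrite big1// => i _; rewrite mul0r.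
- move=> f [fd [fd' [s [ss sd fE]]]]; split=> //; split => //; exists s; split => // i.
  by apply: (leq_trans (sd i)); rewrite ltnS leq_mul2l leqnSn.
- move=> f [fd Qf]; split => //; split; first exact: polys_degBC.
  by apply: subset_closure; exists (f - mpolyC n (min_feasible g f)) => //; exists r.+1.
apply/seteqP; split => [f []//|f fd]; split => //.
have [_ vmin] := vP f.
apply: closure_degP => [|e e0]; first exact: polys_degBC.
apply: quadratic_module_qmodule_infty.
  (* f - v(f) + e is regrouped as f - (v(f) - e) to reuse the degree bound. *)
  rewrite -addrA -mpolyCN -mpolyCD -[X in mpolyC n X]opprK mpolyCN.
  exact: polys_degBC.
apply: (putinar rho0); first exact: qmodule_quadratic_module Qrho.
(* f - v(f) is nonnegative on the feasible set, so adding [e] makes it positive. *)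
move=> x gx; rewrite /peval mevalD mevalB !mevalC.
by rewrite ltr_wpDl// subr_ge0 vmin.
Qed.
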